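(* Let $A:\mathcal{H}\to\mathcal{H}$ be an accretive bounded linear operator on a (real or complex) Hilbert space $\mathcal{H}$ with $\mathcal{R}(A)\neq\mathcal{H}$. Then for each $u\in\mathcal{H}$ and each $\delta>0$ we have $R^\delta_2(u)\le P^\delta(u)$, where $$R^\delta_2(u)=\inf_{\gamma>0}\Big\{\|u_\gamma-u\|^2+\big(\tfrac{\delta}{\gamma}\big)^2\Big\}^{1/2},\qquad P^\delta(u)=\sup_{f^\delta\in\mathcal{H}:\ \|Au-f^\delta\|\le\delta}\ \inf_{\gamma>0}\|(A+\gamma I)^{-1}f^\delta-u\|.$$
   Context: A bounded linear operator $A:\mathcal{H}\to\mathcal{H}$ on a real or complex Hilbert space is called accretive if $\mathrm{Re}\,\langle Au,u\rangle\ge 0$ for all $u\in\mathcal{H}$; then for every $\gamma>0$ the operator $A+\gamma I$ has a bounded inverse with $\|(A+\gamma I)^{-1}\|\le 1/\gamma$. $\mathcal{R}(A)$ denotes the range of $A$. For $u\in\mathcal{H}$ and $\gamma>0$ put $u_\gamma:=(A+\gamma I)^{-1}Au$, so that $u_\gamma-u=-\gamma(A+\gamma I)^{-1}u$. *)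

(* Defs.v *)
From HB Require Import structures.
From mathcomp Require Import all_boot all_order all_algebra.
From mathcomp Require Import sesquilinear complex.
From mathcomp Require Import all_classical all_reals all_analysis.

Set Implicit Arguments.
Unset Strict Implicit.
Unset Printing Implicit Defensive.

Import Order.TTheory GRing.Theory Num.Theory.
Import numFieldNormedType.Exports.

Local Open Scope classical_set_scope.
Local Open Scope ring_scope.

Variant scalar_kind := RealScalars | ComplexScalars.

Definition scalar_field (R : realType) (k : scalar_kind) : numFieldType :=
  match k with
  | RealScalars => R
  | ComplexScalars => R[i]
  end.

Definition scalar_conj (R : realType) (k : scalar_kind) :
    scalar_field R k -> scalar_field R k :=
  match k with
  | RealScalars => idfun
  | ComplexScalars => Num.conj
  end.

Definition scalar_Re (R : realType) (k : scalar_kind) : scalar_field R k -> R :=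
  match k with
  | RealScalars => idfun
  | ComplexScalars => @complex.Re R
  end.

Definition of_real (R : realType) (k : scalar_kind) : R -> scalar_field R k :=
  match k with
  | RealScalars => idfun
  | ComplexScalars => fun x => Complex x 0
  end.

Arguments scalar_conj {R} k _.
Arguments scalar_Re {R} k _.
Arguments of_real {R} k _.

Section Lavrentiev.
Variables (R : realType) (k : scalar_kind).
Variable (H : completeNormedModType (scalar_field R k)).

(* The inner product is linear in its first argument and conjugate-linear in
   its second one; the completeness and the topology of the space are those of
   its [completeNormedModType] structure, whose norm it has to induce. *)
Definition induces_norm (dot : {dot H for scalar_conj k}) :=
  forall u : H, `|u| ^+ 2 = dot u u.

(* In [H] the norm is valued in the scalars (with zero imaginary part). *)
Definition rnorm (u : H) : R := scalar_Re k `|u|.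

Definition bounded_operator (A : H -> H) :=
  exists M : R, forall u, rnorm (A u) <= M * rnorm u.

Definition accretive (dot : {dot H for scalar_conj k}) (A : H -> H) :=
  forall u, 0 <= scalar_Re k (dot (A u) u).

(* The function [(A + g I)^-1]; when [A] is bounded and accretive and [g > 0],
   [A + g I] is a bijection of [H], so that the default value 0 is not used. *)
Definition resolvent (A : H -> H) (g : R) : H -> H :=
  'pinv_(fun=> 0) setT (fun u => A u + of_real k g *: u).

Definition u_gamma (A : H -> H) (u : H) (g : R) : H := resolvent A g (A u).

(* Infima and suprema are taken in [\bar R], where they are unconditional. *)
Definition R2 (A : H -> H) (delta : R) (u : H) : \bar R :=
  ereal_inf [set (Num.sqrt (rnorm (u_gamma A u g - u) ^+ 2
                            + (delta / g) ^+ 2))%:E | g in [set g | 0 < g]].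

Definition P (A : H -> H) (delta : R) (u : H) : \bar R :=
  ereal_sup
    [set ereal_inf [set (rnorm (resolvent A g f - u))%:E | g in [set g | 0 < g]]
    | f in [set f | rnorm (A u - f) <= delta]].

End Lavrentiev.

(* Main.v *)
Require Import Defs.
From HB Require Import structures.
From mathcomp Require Import all_boot all_order all_algebra.
From mathcomp Require Import sesquilinear complex.
From mathcomp Require Import all_classical all_reals all_analysis.
From mathcomp Require Import ring lra.

Set Implicit Arguments.
Unset Strict Implicit.
Unset Printing Implicit Defensive.

Import Order.TTheory GRing.Theory Num.Theory.
Import numFieldNormedType.Exports.

Local Open Scope classical_set_scope.
Local Open Scope ring_scope.

(** If A were bounded below, then A + g I would be so uniformly in g, and the
    surjectivity of A + g I for g > 0 would persist for A. Since R(A) <> H,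
    there are thus unit vectors v with A v, and by accretivity also A^* v,
    arbitrarily small; replacing v by - v, one may assume Re <u, v> <= 0. Take
    f = A u + delta v, so that the error of f at g is the sum of u_g - u and
    delta (A + g I)^-1 v. For g bounded away from 0, the second term is close
    to (delta / g) v, and Re <u_g - u, v> = - Re <u, v> + Re <A w, v>, where
    w = (A + g I)^-1 u, is nearly nonnegative, so that the squared norm of the
    error is at least |u_g - u|^2 + (delta / g)^2 up to a small quantity. For
    small g, the smallness of A^* v makes (A + g I)^-1 v so large that the error
    exceeds |u|, which bounds R_2 (let g tend to infinity). *)

(** * Embedding of the reals into the scalars, and real parts *)

Section Scalars.
Context {R : realType} (k : scalar_kind).
Implicit Types (a b : R) (x y : scalar_field R k).

Fact of_real_is_zmod_morphism : zmod_morphism (@of_real R k).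
Proof. by case: k => a b //; apply/eqP; rewrite eq_complex /= subr0 !eqxx. Qed.

Fact of_real_is_monoid_morphism : monoid_morphism (@of_real R k).
Proof.
case: k; split => // a b.
by apply/eqP; rewrite eq_complex /= mulr0 subr0 mulr0 mul0r addr0 !eqxx.
Qed.

HB.instance Definition _ :=
  GRing.isZmodMorphism.Build R (scalar_field R k) (@of_real R k)
    of_real_is_zmod_morphism.
HB.instance Definition _ :=
  GRing.isMonoidMorphism.Build R (scalar_field R k) (@of_real R k)
    of_real_is_monoid_morphism.

Lemma of_realK : cancel (@of_real R k) (scalar_Re k).
Proof. by case: k. Qed.

Lemma ge0_of_real x : 0 <= x -> of_real k (scalar_Re k x) = x.
Proof.
case: k x => //= -[a b]; rewrite lecE /= => /andP[/eqP <- _] //.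
Qed.

Lemma normr_of_real a : `|of_real k a| = of_real k `|a|.
Proof.
case: k => //=; apply/eqP; rewrite eq_complex /=.
by rewrite expr0n /= addr0 sqrtr_sqr !eqxx.
Qed.

Lemma ltr_of_real a b : (of_real k a < of_real k b) = (a < b).
Proof. by case: k => //=; rewrite ltcE /= eqxx. Qed.

Lemma ler_of_real a b : (of_real k a <= of_real k b) = (a <= b).
Proof. by case: k => //=; rewrite lecE /= eqxx. Qed.

Lemma scalar_ReD x y : scalar_Re k (x + y) = scalar_Re k x + scalar_Re k y.
Proof. by case: k x y => //= -[a b] [c d]. Qed.

Lemma scalar_Re_of_realM a x :
  scalar_Re k (of_real k a * x) = a * scalar_Re k x.
Proof. by case: k x => //= -[b c] /=; rewrite mul0r subr0. Qed.

Lemma scalar_Re_conj x : scalar_Re k (scalar_conj k x) = scalar_Re k x.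
Proof. by case: k x => //= -[a b]. Qed.

End Scalars.

(** * The norm as a real number *)

Section RealNorm.
Context {R : realType} {k : scalar_kind}.
Context {H : completeNormedModType (scalar_field R k)}.
Implicit Types (a b : R) (u v w : H).

Lemma normE u : `|u| = of_real k (rnorm u).
Proof. by rewrite ge0_of_real. Qed.

Lemma rnorm_ge0 u : 0 <= rnorm u.
Proof. by rewrite -(ler_of_real k) rmorph0 -normE. Qed.

Lemma rnormD u v : rnorm (u + v) <= rnorm u + rnorm v.
Proof. by rewrite -(ler_of_real k) rmorphD /= -!normE ler_normD. Qed.

Lemma rnormN u : rnorm (- u) = rnorm u.
Proof. by rewrite /rnorm normrN. Qed.

Lemma rnormB u v : rnorm (u - v) = rnorm (v - u).
Proof. by rewrite -rnormN opprB. Qed.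

Lemma rnormZ a u : rnorm (of_real k a *: u) = `|a| * rnorm u.
Proof. by rewrite /rnorm normrZ normr_of_real scalar_Re_of_realM. Qed.

Lemma rnorm_eq0 u : (rnorm u == 0) = (u == 0).
Proof.
by rewrite -(inj_eq (can_inj (of_realK k))) -normE rmorph0 normr_eq0.
Qed.

Lemma rnorm0 : rnorm (0 : H) = 0.
Proof. by apply/eqP; rewrite rnorm_eq0. Qed.

(** Positive scalars are embedded reals, so real radii suffice to test Cauchy sequences and
    limits. *)
Lemma rnorm_complete (y : nat -> H) :
  (forall e : R, 0 < e ->
    exists n, forall m, (n <= m)%N -> rnorm (y n - y m) < e) ->
  exists p, forall e : R, 0 < e ->
    exists n, forall m, (n <= m)%N -> rnorm (p - y m) < e.
Proof.
move=> y_cauchy.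
have /cauchy_cvg/cvg_ex[p yp] : cauchy (y @ \oo).
  apply: cauchy_exP => e e0; move: (e0).
  rewrite -(ge0_of_real (ltW e0)) -(rmorph0 (of_real k)) ltr_of_real.
  move=> /y_cauchy[n ny]; exists (y n); exists n => // m /= nm.
  by rewrite -ball_normE /= normE ltr_of_real ny.
exists p => e e0.
have /cvgrPdist_lt/(_ (of_real k e)) [|n _ ny] := yp.
  by rewrite -(rmorph0 (of_real k)) ltr_of_real.
by exists n => m nm; have := ny m nm; rewrite normE ltr_of_real.
Qed.

End RealNorm.

(** * Fixed points and Lipschitz perturbations of surjections *)

Section Contraction.
Context {R : realType} {k : scalar_kind}.
Context {H : completeNormedModType (scalar_field R k)}.

(** Picard iteration from [0]; the geometric tail bound is kept multiplied by [1 - q], free of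
    division. *)
Lemma contraction_fixpoint (f : H -> H) (q : R) : 0 <= q -> q < 1 ->
  (forall u v, rnorm (f u - f v) <= q * rnorm (u - v)) -> exists p, f p = p.
Proof.
move=> q0 q1 f_lip; pose y n := iter n f 0; pose d := rnorm (y 1 - y 0).
have q1' : 0 < 1 - q by rewrite subr_gt0.
have d0 : 0 <= d by exact: rnorm_ge0.
have d1 : 0 < d + 1 by lra.
have step n : rnorm (y n.+1 - y n) <= q ^+ n * d.
  elim: n => [|n IHn]; first by rewrite mul1r.
  by rewrite (le_trans (f_lip _ _))// exprS -mulrA ler_wpM2l.
have tail n m :
    (1 - q) * rnorm (y n - y (n + m)%N) <= (q ^+ n - q ^+ (n + m)) * d.
  elim: m => [|m IHm]; first by rewrite addn0 !subrr rnorm0 mulr0 mul0r.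
  have := rnormD (y n - y (n + m)%N) (y (n + m)%N - y (n + m).+1).
  rewrite addrA subrK [X in _ <= _ + X]rnormB addnS => /le_trans.
  move=> /(_ _ (lerD (lexx _) (step _))) /(ler_wpM2l (ltW q1')).
  move=> /le_trans; apply.
  rewrite mulrDr exprS; move: IHm; set X := rnorm _; set Q := q ^+ (n + m).
  set Q' := q ^+ n => IHm; lra.
have [e e0|p py] := @rnorm_complete _ _ _ y.
  (* [d + 1] stands in for [d], which is zero when [0] is already a fixed point. *)
  have /cvgrPdist_lt/(_ (e * (1 - q) / (d + 1))) [] :
      q ^+ n @[n --> \oo] --> 0.
  - by apply: cvg_expr; rewrite ger0_norm.
    by rewrite divr_gt0 ?mulr_gt0.
  move=> n _ /(_ n (leqnn n)); rewrite sub0r normrN ger0_norm ?exprn_ge0//.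
  rewrite ltr_pdivlMr// => qn; exists n => m /subnKC <-.
  rewrite -(ltr_pM2l q1') (le_lt_trans (tail _ _))// [ltRHS]mulrC.
  apply: le_lt_trans qn; apply: ler_pM => //; last by rewrite lerDl.
    by rewrite subr_ge0 exprD ler_piMr ?exprn_ge0// exprn_ile1 // ltW.
  by rewrite lerBlDr lerDl exprn_ge0.
exists p; apply/eqP; rewrite -subr_eq0 -rnorm_eq0 eq_le rnorm_ge0 andbT.
apply/ler_addgt0Pr => e e0; rewrite add0r.
have [|n ny] := py (e / 2); first by rewrite divr_gt0.
have -> : f p - p = (f p - f (y n)) + (y n.+1 - p) by rewrite addrA subrK.
rewrite (le_trans (rnormD _ _))// [leRHS]splitr lerD//.
  rewrite (le_trans (f_lip _ _))// (le_trans _ (ltW (ny n _)))//.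
  by rewrite ler_piMl ?rnorm_ge0// ltW.
by rewrite rnormB ltW// ny.
Qed.

(** A solution is a fixed point of [u |-> G (w - T u)], with [G] a right inverse of [B]. The lower
    bound makes [G] Lipschitz with constant [1 / c], so this map contracts by [t / c]. *)
Lemma lipschitz_perturb_surj (B T : H -> H) (c t : R) : 0 <= t -> t < c ->
  (forall u v, c * rnorm (u - v) <= rnorm (B u - B v)) ->
  (forall u v, rnorm (T u - T v) <= t * rnorm (u - v)) ->
  (forall w, exists u, B u = w) -> forall w, exists u, B u + T u = w.
Proof.
move=> t0 tc B_low T_lip /choice[G BG] w.
have c0 : 0 < c by exact: le_lt_trans tc.
have [| | |p fp] := @contraction_fixpoint (fun u => G (w - T u)) (t / c).
- by rewrite divr_ge0// ltW.
- by rewrite ltr_pdivrMr// mul1r.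
- move=> u v /=; rewrite mulrAC ler_pdivlMr// mulrC.
  rewrite (le_trans (B_low _ _))// !BG.
  by rewrite opprB [X in rnorm X]addrC addrA subrK rnormB T_lip.
by exists p; rewrite -{1}fp BG subrK.
Qed.

End Contraction.

(** * The real part of the inner product *)

Section InnerProduct.
Context {R : realType} {k : scalar_kind}.
Context {H : completeNormedModType (scalar_field R k)}.
Variable dot : {dot H for scalar_conj k}.
Hypothesis dot_norm : induces_norm dot.
Implicit Types (a b : R) (u v w : H).

(** A symmetric real bilinear form for either kind of scalars, so that both cases share one
    argument. *)
Definition rdot u v := scalar_Re k (dot u v).

Lemma rdotC u v : rdot u v = rdot v u.
Proof. by rewrite /rdot hermitian_subproof expr0 mul1r scalar_Re_conj. Qed.

Lemma rdotDl u v w : rdot (u + v) w = rdot u w + rdot v w.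
Proof. by rewrite /rdot linearDl scalar_ReD. Qed.

Lemma rdotZl a u v : rdot (of_real k a *: u) v = a * rdot u v.
Proof. by rewrite /rdot linearZl_LR scalar_Re_of_realM. Qed.

Lemma rdotDr u v w : rdot u (v + w) = rdot u v + rdot u w.
Proof. by rewrite rdotC rdotDl !(rdotC u). Qed.

Lemma rdotZr a u v : rdot u (of_real k a *: v) = a * rdot u v.
Proof. by rewrite rdotC rdotZl rdotC. Qed.

Lemma rdotNl u v : rdot (- u) v = - rdot u v.
Proof.
by rewrite -scaleN1r -(rmorph1 (of_real k)) -rmorphN rdotZl mulN1r.
Qed.

Lemma rdotNr u v : rdot u (- v) = - rdot u v.
Proof. by rewrite rdotC rdotNl rdotC. Qed.

Lemma rnormE u : rnorm u ^+ 2 = rdot u u.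
Proof.
by rewrite /rdot -dot_norm normE expr2 scalar_Re_of_realM of_realK.
Qed.

Lemma sqr_rnormD u v :
  rnorm (u + v) ^+ 2 = rnorm u ^+ 2 + 2 * rdot u v + rnorm v ^+ 2.
Proof. by rewrite !rnormE rdotDl !rdotDr (rdotC v u); ring. Qed.

(** Cauchy-Schwarz, read off from the squared triangle inequality. *)
Lemma rdot_le u v : rdot u v <= rnorm u * rnorm v.
Proof.
have : rnorm (u + v) ^+ 2 <= (rnorm u + rnorm v) ^+ 2.
  by rewrite lerXn2r ?nnegrE ?addr_ge0 ?rnorm_ge0// rnormD.
by rewrite sqr_rnormD; lra.
Qed.

End InnerProduct.

(** * Resolvents and approximate kernel vectors of an accretive operator *)

Section AccretiveOperator.
Context {R : realType} {k : scalar_kind}.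
Context {H : completeNormedModType (scalar_field R k)}.
Variables (dot : {dot H for scalar_conj k}) (A : {linear H -> H}).
Hypothesis dot_norm : induces_norm dot.
Hypothesis A_bounded : bounded_operator A.
Hypothesis A_accretive : accretive dot A.
Implicit Types (g : R) (u v w : H).

Definition shifted g u := A u + of_real k g *: u.

Lemma shiftedB g u v : shifted g (u - v) = shifted g u - shifted g v.
Proof. by rewrite /shifted linearB scalerBr addrACA opprD. Qed.

(** Accretivity gives Re <(A + g I) u, u> >= g |u|^2; by Cauchy-Schwarz one factor |u| cancels. *)
Lemma shifted_lower_bound g u : g * rnorm u <= rnorm (shifted g u).
Proof.
have [n0|n0] := eqVneq (rnorm u) 0; first by rewrite n0 mulr0 rnorm_ge0.
have n_gt0 : 0 < rnorm u by rewrite lt_def n0 rnorm_ge0.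
rewrite -(ler_pM2r n_gt0) (le_trans _ (rdot_le dot_norm _ _))//.
rewrite /shifted rdotDl rdotZl -rnormE// expr2 mulrA lerDr; exact: A_accretive.
Qed.

Lemma shifted_inj g : 0 < g -> injective (shifted g).
Proof.
move=> g0 u v /= uv; apply/eqP; rewrite -subr_eq0 -rnorm_eq0 eq_le rnorm_ge0.
rewrite andbT -(pmulr_rle0 _ g0) (le_trans (shifted_lower_bound _ _))//.
by rewrite shiftedB uv subrr rnorm0.
Qed.

Lemma operator_bound :
  exists2 M : R, 0 < M & forall u, rnorm (A u) <= M * rnorm u.
Proof.
have [M AM] := A_bounded; exists (`|M| + 1); first by rewrite ltr_wpDl.
move=> u; rewrite (le_trans (AM u))// ler_wpM2r ?rnorm_ge0//.
by rewrite ler_wpDr ?ler_norm.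
Qed.

(* A + g I is a small perturbation of g I for large g, and of A + 2 g I in
   general, so surjectivity spreads to every g > 0 by halving. *)
Lemma shifted_surj g w : 0 < g -> exists u, shifted g u = w.
Proof.
have [M M0 AM] := operator_bound.
suff surj n : forall g w, 0 < g -> M < 2 ^+ n * g -> exists u, shifted g u = w.
  move=> g0.
  have [n _ Mn] := near_infty_natSinv_expn_lt (PosNum (divr_gt0 g0 M0)).
  apply: (surj n) => //; have /= := Mn n (leqnn n).
  by rewrite ltr_pdivlMr// mulrC mulrA mulr1 ltr_pdivrMr ?exprn_gt0// mulrC.
elim: n => [|n IHn] {}g {}w g0 Mg.
  have [|||||u <-] := @lipschitz_perturb_surj _ _ _
    (fun u => of_real k g *: u) A g M _ _ _ _ _ w.
  - exact: ltW.
  - by rewrite expr0 mul1r in Mg.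
  - by move=> u v; rewrite -scalerBr rnormZ gtr0_norm.
  - by move=> u v; rewrite -linearB.
  - move=> {}w; exists (of_real k g^-1 *: w).
    by rewrite scalerA -rmorphM mulfV ?gt_eqF// rmorph1 scale1r.
  by exists u; rewrite /shifted addrC.
have [|||||u <-] := @lipschitz_perturb_surj _ _ _
  (shifted (g *+ 2)) (fun u => - (of_real k g *: u)) (g *+ 2) g _ _ _ _ _ w.
- exact: ltW.
- lra.
- by move=> u v; rewrite -shiftedB shifted_lower_bound.
- by move=> u v; rewrite -opprD -scalerBr rnormN rnormZ gtr0_norm.
- move=> {}w; apply: IHn; first by rewrite pmulrn_lgt0.
  by rewrite mulrnAr -mulr_natl mulrA -exprS.
by exists u; rewrite /shifted -addrA -scaleNr -scalerDl -rmorphN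
  -rmorphD /= mulr2n addrK.
Qed.

(** [A + (e / 3) I] is onto and bounded below by [e - e / 3], which exceeds the Lipschitz constant
    [e / 3] of the term to be subtracted. *)
Lemma bounded_below_surj (e : R) : 0 < e ->
  (forall u, e * rnorm u <= rnorm (A u)) -> range A = [set: H].
Proof.
move=> e0 A_low; apply/seteqP; split=> // w _.
have e30 : 0 < e / 3 by rewrite divr_gt0.
have [|||||u uw] := @lipschitz_perturb_surj _ _ _
  (shifted (e / 3)) (fun u => - (of_real k (e / 3) *: u))
  (e - e / 3) (e / 3) _ _ _ _ _ w.
- exact: ltW.
- lra.
- move=> u v; rewrite -shiftedB; have := A_low (u - v).
  have := rnormD (shifted (e / 3) (u - v)) (- (of_real k (e / 3) *: (u - v))).
  rewrite {2}/shifted addrK rnormN rnormZ gtr0_norm//; lra.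
- by move=> u v; rewrite -opprD -scalerBr rnormN rnormZ gtr0_norm.
- by move=> {}w; apply: shifted_surj.
by exists u => //; rewrite -uw /shifted addrK.
Qed.

Lemma resolventK g u : 0 < g -> shifted g (resolvent A g u) = u.
Proof.
move=> g0; rewrite /resolvent.
apply: (@pinvK _ _ _ setT (shifted g)); rewrite inE.
by have [v <-] := shifted_surj u g0; exists v.
Qed.

(* A small value of <A v, v> makes v almost minimise the nonnegative quadratic
   form z |-> Re <A z, z>, so that its derivative at v in the direction w, and
   with it Re <A w, v>, is small: v is also an approximate kernel vector of the
   adjoint. *)
Lemma approximate_kernel (e : R) : range A != [set: H] -> 0 < e ->
  exists v, [/\ rnorm v = 1, rnorm (A v) <= e &
    forall w, - (e * rnorm w) <= rdot dot (A w) v <= e * rnorm w].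
Proof.
move=> A_range e0; have [M M0 AM] := operator_bound.
(* Chosen so that [s * M = e / 2] and [d * (1 + s) = e * s / 2]: the error terms below share the
   tolerance equally. *)
pose s := e / (2 * M); pose d := e * s / (2 * (1 + s)).
have s0 : 0 < s by rewrite divr_gt0 ?mulr_gt0.
have s1 : 0 < 1 + s by lra.
have d0 : 0 < d by rewrite /d divr_gt0// mulr_gt0.
have sM : s * M = e / 2 by rewrite /s; field; rewrite gt_eqF.
have ds : d * (1 + s) = e * s / 2 by rewrite /d; field; lra.
have [v0 v0d] : exists v, rnorm (A v) < d * rnorm v.
  apply: contrapT => /forallNP A_low; move/eqP: A_range; apply.
  apply: (bounded_below_surj d0) => u.
  by move/negP: (A_low u); rewrite -leNgt.
have v0_gt0 : 0 < rnorm v0.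
  by rewrite -(pmulr_rgt0 _ d0) (le_lt_trans _ v0d)// rnorm_ge0.
have [v v1 Avd] : exists2 v, rnorm v = 1 & rnorm (A v) <= d.
  exists (of_real k (rnorm v0)^-1 *: v0).
    by rewrite rnormZ gtr0_norm ?invr_gt0// mulVf ?gt_eqF.
  by rewrite linearZ rnormZ gtr0_norm ?invr_gt0// mulrC ler_pdivrMr// ltW.
have lower w : - (e * rnorm w) <= rdot dot (A w) v.
  have [w0|w_neq0] := eqVneq w 0.
    rewrite w0 linear0 rnorm0 mulr0 oppr0 /rdot linear0l.
    by rewrite -(rmorph0 (of_real k)) of_realK.
  set n := rnorm w.
  have n0 : 0 < n by rewrite lt_def rnorm_eq0 w_neq0 rnorm_ge0.
  (* Accretivity is tested at [n v + s w]; once the other terms are bounded, dividing by [n * s]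
     leaves [0 <= n * e + X]. *)
  have nonneg := A_accretive (of_real k n *: v + of_real k s *: w).
  rewrite -/(rdot _ _ _) linearD !linearZ in nonneg.
  rewrite rdotDl !rdotDr !rdotZl !rdotZr in nonneg.
  have := rdot_le dot_norm (A v) v; rewrite v1.
  have := rdot_le dot_norm (A v) w.
  have := rdot_le dot_norm (A w) w.
  have := AM w; rewrite -/n.
  move: (rdot dot (A v) v) (rdot dot (A v) w) (rdot dot (A w) w) nonneg.
  move: (rdot dot (A w) v) => X a b c nonneg Awn cw bv av.
  have cn : c <= M * n * n by rewrite (le_trans cw)// ler_wpM2r// ltW.
  have bn : b <= d * n by rewrite (le_trans bv)// ler_wpM2r// ltW.
  have an : a <= d by rewrite (le_trans av)// mulr1.
  have : 0 <= (n * s) * (n * e + X).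
    apply: (le_trans nonneg).
    have -> : (n * s) * (n * e + X) =
        n * (n * (d * (1 + s))) + n * (s * X) + s * (s * M * n * n).
      by rewrite ds sM; field.
    have : n * (n * a) <= n * (n * d) by rewrite !ler_pM2l.
    have : n * (s * b) <= n * (s * (d * n)) by rewrite !ler_pM2l.
    have : s * (s * c) <= s * (s * (M * n * n)) by rewrite !ler_pM2l.
    by lra.
  by rewrite (pmulr_rge0 _ (mulr_gt0 n0 s0)); lra.
exists v; split=> //.
  rewrite (le_trans Avd)// /d ler_pdivrMr ?mulr_gt0//.
  by rewrite ler_pM2l//; lra.
move=> w; rewrite lower/=.
by have := lower (- w); rewrite linearN rdotNl rnormN lerN2.
Qed.

End AccretiveOperator.

(** * The error at a fixed [g] for noise along an approximate kernel vector *)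

Section LavrentievError.
Context {R : realType} {k : scalar_kind}.
Context {H : completeNormedModType (scalar_field R k)}.
Variables (dot : {dot H for scalar_conj k}) (A : {linear H -> H}).
Hypothesis dot_norm : induces_norm dot.
Hypothesis A_bounded : bounded_operator A.
Hypothesis A_accretive : accretive dot A.
Variables (u v : H) (delta g : R).
Hypotheses (delta_gt0 : 0 < delta) (g_gt0 : 0 < g).

Let resK w : A (resolvent A g w) + of_real k g *: resolvent A g w = w.
Proof. exact: (resolventK dot_norm A_bounded A_accretive). Qed.

Let inj x y : A x + of_real k g *: x = A y + of_real k g *: y -> x = y.
Proof. exact: (shifted_inj dot_norm A_accretive g_gt0). Qed.

Lemma rnorm_resolvent w : g * rnorm (resolvent A g w) <= rnorm w.
Proof.
rewrite (le_trans (shifted_lower_bound dot_norm A_accretive _ _))//.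
by rewrite /shifted resK.
Qed.

Lemma u_gammaE : u_gamma A u g - u = - (of_real k g *: resolvent A g u).
Proof.
apply/eqP; rewrite subr_eq addrC; apply/eqP/inj; rewrite resK.
rewrite linearB scalerBr linearZ addrACA -opprD -scalerDr resK.
by rewrite addrK.
Qed.

Lemma resolvent_noiseE : resolvent A g (A u + of_real k delta *: v) - u =
  (u_gamma A u g - u) + of_real k delta *: resolvent A g v.
Proof.
rewrite addrAC; congr (_ - _); apply: inj.
rewrite resK linearD linearZ scalerDr.
rewrite addrACA resK [of_real k g *: (_ *: _)]scalerA [of_real k g * _]mulrC.
by rewrite -scalerA -scalerDr resK.
Qed.

Lemma rnorm_u_gamma : rnorm (u_gamma A u g - u) <= rnorm u.
Proof. by rewrite u_gammaE rnormN rnormZ gtr0_norm// rnorm_resolvent. Qed.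

Variable e : R.
Hypotheses (e_gt0 : 0 < e) (v1 : rnorm v = 1) (Av_le : rnorm (A v) <= e).
Hypothesis A_v : forall w, - (e * rnorm w) <= rdot dot (A w) v <= e * rnorm w.

Let err := resolvent A g (A u + of_real k delta *: v) - u.

(** Pairing [(A + g I) x = v] with [v] gives [1 <= (g + e) |x|], hence [delta |x| >= 2 |u| + 1], of
    which u_g - u cancels at most |u|. The added 1 keeps the denominator positive when [u = 0]. *)
Lemma error_small_gamma :
  g + e <= delta / (2 * rnorm u + 1) -> rnorm u <= rnorm err.
Proof.
have u0 := rnorm_ge0 u; rewrite ler_pdivlMr; last by lra.
set x := resolvent A g v => ge_le.
have x_ge : 1 <= rnorm x * (g + e).
  have := rdotDl dot (A x) (of_real k g *: x) v.
  rewrite rdotZl resK -rnormE// v1 expr1n.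
  have := rdot_le dot_norm x v; rewrite v1 mulr1 => xv.
  have /andP[_] := A_v x.
  by have := ler_wpM2l (ltW g_gt0) xv; lra.
have ge_gt0 : 0 < g + e by rewrite addr_gt0.
have x_low : 2 * rnorm u + 1 <= delta * rnorm x.
  rewrite -(ler_pM2l ge_gt0) (le_trans ge_le)//.
  by rewrite mulrCA ler_peMr 1?mulrC// ltW.
have := rnormD err (- (u_gamma A u g - u)).
rewrite /err resolvent_noiseE addrAC subrr add0r rnormN rnormZ gtr0_norm// -/x.
by have := rnorm_u_gamma; lra.
Qed.

(** The square root would be the norm of [y], the sum of u_g - u and [(delta / g) v], were these
    orthogonal. Their failure to be so costs the first term in [e]; passing from [y] to the true
    error costs the second. *)
Lemma error_large_gamma : rdot dot u v <= 0 ->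
  Num.sqrt (rnorm (u_gamma A u g - u) ^+ 2 + (delta / g) ^+ 2) <=
  rnorm err + e * (2 * rnorm u / g + delta / g ^+ 2).
Proof.
move=> uv_le0; set G := u_gamma A u g - u; set N := Num.sqrt _.
have N2 : N ^+ 2 = rnorm G ^+ 2 + (delta / g) ^+ 2.
  by rewrite sqr_sqrtr// addr_ge0// sqr_ge0.
have dg : 0 < delta / g by rewrite divr_gt0.
have N_ge : delta / g <= N.
  rewrite -[leLHS]gtr0_norm// -sqrtr_sqr ler_wsqrtr// lerDr sqr_ge0 //.
have Gv : - (e * rnorm u / g) <= rdot dot G v.
  set w := resolvent A g u.
  have := rdotDl dot (A w) (of_real k g *: w) v; rewrite resK.
  rewrite /G u_gammaE rdotNl -/w.
  have : e * rnorm w <= e * rnorm u / g.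
    by rewrite -mulrA ler_pM2l// ler_pdivlMr// mulrC rnorm_resolvent.
  have /andP[+ _] := A_v w; lra.
set y := G + of_real k (delta / g) *: v.
have y2 : rnorm y ^+ 2 = N ^+ 2 + 2 * (delta / g) * rdot dot G v.
  rewrite /y (sqr_rnormD dot_norm) rdotZr rnormZ gtr0_norm// v1 mulr1 N2; ring.
(* Twice the bound on [- rdot dot G v]. If [N > c], the squares of [N - c] and [rnorm y] are
   compared, using [delta / g <= N]. *)
pose c := 2 * (e * rnorm u / g).
have c0 : 0 <= c by rewrite /c !mulr_ge0 ?invr_ge0 ?rnorm_ge0// ltW.
have y_ge : N <= rnorm y + c.
  have [/le_trans->//|cN] := leP N c; first by rewrite lerDr rnorm_ge0.
  rewrite -lerBlDr -(@ler_pXn2r _ 2)// ?nnegrE ?subr_ge0 ?rnorm_ge0 ?(ltW cN)//.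
  rewrite y2 sqrrB.
  have : (delta / g) * c <= N * c by rewrite ler_wpM2r.
  have : c * c <= N * c by rewrite ler_wpM2r// ltW.
  have : (delta / g) * (- (e * rnorm u / g)) <= (delta / g) * rdot dot G v.
    by rewrite ler_pM2l.
  rewrite /c; move: (e * rnorm u / g) => z; lra.
set x := resolvent A g v.
(* [A] commutes with [A + g I], so [(A + g I) (A x) = A v]. *)
have Ax : rnorm (A x) <= e / g.
  rewrite ler_pdivlMr// mulrC.
  rewrite (le_trans (shifted_lower_bound dot_norm A_accretive _ _))//.
  by rewrite /shifted -linearZ -linearD resK.
(* Substitute [v = A x + g x] in [(delta / g) v]. *)
have errE : y = err + of_real k (delta / g) *: A x.
  rewrite /y /err resolvent_noiseE -/x -/G -[RHS]addrA; congr (_ + _).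
  rewrite -[in LHS](resK v) -/x scalerDr addrC scalerA -rmorphM divfK ?gt_eqF//.
have := rnormD err (of_real k (delta / g) *: A x).
rewrite -errE rnormZ gtr0_norm//.
have : delta / g * rnorm (A x) <= delta / g * (e / g) by rewrite ler_pM2l.
have -> : e * (2 * rnorm u / g + delta / g ^+ 2) = c + delta / g * (e / g).
  by rewrite /c; field; rewrite gt_eqF.
lra.
Qed.

End LavrentievError.

(** * Choice of the noise and comparison of the two errors *)

Theorem theorem3p8 (R : realType) (k : scalar_kind)
    (H : completeNormedModType (scalar_field R k))
    (dot : {dot H for scalar_conj k}) (A : {linear H -> H})
    (dot_norm : induces_norm dot)
    (A_bounded : bounded_operator A)
    (A_accretive : accretive dot A)
    (A_range : range A != [set: H])
    (u : H) (delta : R) (delta_gt0 : 0 < delta) :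
  (R2 A delta u <= P A delta u)%E.
Proof.
have u0 := rnorm_ge0 u.
have R2_le : (R2 A delta u <= (rnorm u)%:E)%E.
  apply/lee_addgt0Pr => e e0; rewrite -EFinD.
  (* At [g = delta / e] the noise term [delta / g] is exactly [e]. *)
  have g0 : 0 < delta / e by rewrite divr_gt0.
  apply: (@le_trans _ _ (Num.sqrt (rnorm (u_gamma A u (delta / e) - u) ^+ 2 +
      (delta / (delta / e)) ^+ 2))%:E).
    by apply: ereal_inf_lbound; exists (delta / e).
  rewrite lee_fin -[leRHS]gtr0_norm; last by lra.
  rewrite -sqrtr_sqr ler_wsqrtr// invf_div mulrCA mulfV ?gt_eqF// mulr1.
  rewrite sqrrD lerD2r ler_wpDr ?mulrn_wge0 ?mulr_ge0 ?(ltW e0)//.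
  by rewrite lerXn2r ?nnegrE ?rnorm_ge0// (rnorm_u_gamma dot_norm).
apply/lee_addgt0Pr => eps eps0.
(* Half the threshold for small [g], leaving the other half for [e]. *)
pose g0 := delta / (2 * rnorm u + 1) / 2.
have g0_gt0 : 0 < g0 by rewrite !divr_gt0//; lra.
pose K := 2 * rnorm u / g0 + delta / g0 ^+ 2.
have K0 : 0 < K.
  rewrite ltr_wpDl ?divr_gt0 ?exprn_gt0//.
  by rewrite divr_ge0 ?(ltW g0_gt0)// mulr_ge0.
(* [e <= g0] serves [g <= g0]; [e * K <= eps] serves [g > g0], where [K] dominates the coefficient
   of [e]. *)
pose e := Num.min g0 (eps / K).
have e0 : 0 < e by rewrite lt_min g0_gt0 divr_gt0.
have [v0 [v01 Av0 A_v0]] :=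
  approximate_kernel dot_norm A_bounded A_accretive A_range e0.
have [v [v1 Av A_v uv]] : exists v, [/\ rnorm v = 1, rnorm (A v) <= e,
    forall w, - (e * rnorm w) <= rdot dot (A w) v <= e * rnorm w &
    rdot dot u v <= 0].
  have [uv0|uv0] := leP (rdot dot u v0) 0; first by exists v0.
  exists (- v0); rewrite linearN !rnormN rdotNr oppr_le0 (ltW uv0).
  split=> // w.
  by rewrite rdotNr lerN2 lerNl andbC.
pose f := A u + of_real k delta *: v.
apply: (@le_trans _ _ (ereal_inf [set (rnorm (resolvent A g f - u)%R)%:E
    | g in [set g : R | (0 < g)%R]] + eps%:E)%E); last first.
  rewrite leeD2r//; apply: ereal_sup_ubound; exists f => //=.
  by rewrite /f opprD addrA subrr add0r rnormN rnormZ v1 mulr1 gtr0_norm.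
rewrite -leeBlDr//; apply: le_ereal_inf_tmp => _ [g /= g_gt0 <-].
rewrite EFinN leeBlDr// -EFinD.
have [g_le|g_ge] := leP g g0.
  rewrite (le_trans R2_le)// lee_fin ler_wpDr ?(ltW eps0)//.
  apply: (error_small_gamma dot_norm A_bounded A_accretive delta_gt0 g_gt0 e0 v1
    A_v).
  rewrite [leRHS]splitr lerD//; rewrite ge_min; apply/orP; left; exact: lexx.
apply: (@le_trans _ _ (Num.sqrt (rnorm (u_gamma A u g - u) ^+ 2 +
    (delta / g) ^+ 2))%:E).
  by apply: ereal_inf_lbound; exists g.
rewrite lee_fin.
rewrite (le_trans (error_large_gamma dot_norm A_bounded A_accretive delta_gt0
  g_gt0 e0 v1 Av A_v uv))// lerD2l.
apply: (@le_trans _ _ (e * K)).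
  rewrite ler_pM2l// lerD//.
    by rewrite ler_wpM2l ?mulr_ge0// lef_pV2 ?posrE// ltW.
  rewrite ler_pM2l// lef_pV2 ?posrE ?exprn_gt0//.
  by rewrite lerXn2r ?nnegrE ?(ltW g_gt0) ?(ltW g0_gt0) ?(ltW g_ge).
by rewrite -ler_pdivlMr// ge_min lexx orbT.
Qed.
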